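(* Let $C$ be of finite type. The dual canonical basis $\{C_{\alpha,b}=\mathbb K_\alpha\diamond C_b\mid\alpha\in\mathbb N^{\mathbb I},\,b\in\mathbf C\}$ of $\widehat{\mathbf B}^\imath_\tau$ is preserved by the anti-involution $\sigma^\imath$. Moreover, $$\sigma^\imath(C_{\alpha,b})=C_{\tau\alpha,\sigma(b)}\qquad\text{for all }\alpha\in\mathbb N^{\mathbb I},\ b\in\mathbf C.$$
   Context: Root data. $C=(c_{ij})_{i,j\in\mathbb I}$ is a Cartan matrix of finite type, $D=\mathrm{diag}(d_i)$, $d_i\in\mathbb Z_{>0}$, $DC$ symmetric; $\mathbb Z^{\mathbb I}=\bigoplus_i\mathbb Z\alpha_i\supset\mathbb N^{\mathbb I}$, $(\alpha_i,\alpha_j)=d_ic_{ij}$. $v$ is an indeterminate, $v_i=v^{d_i}$. $\tau$ is a permutation of $\mathbb I$ with $\tau^2=\mathrm{id}$, $c_{\tau i,\tau j}=c_{ij}$, $d_{\tau i}=d_i$, extended linearly to $\mathbb Z^{\mathbb I}$. iHopf algebra. $\mathbf f$ is the $\mathbb Q(v^{1/2})$-algebra generated by $\vartheta_i$ ($i\in\mathbb I$) subject to the quantum Serre relations, $\mathrm{wt}(\vartheta_i)=\alpha_i$; it is Lusztig's algebra with $\vartheta_i=(v_i-v_i^{-1})\theta_i$. $\sigma$ is the $\mathbb Q(v^{1/2})$-linear anti-involution of $\mathbf f$ fixing each $\vartheta_i$ (it is known that $\sigma(\mathbf C)=\mathbf C$ for $\mathbf C$ below). $\widehat{\mathbf B}$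 is generated by $\mathbf f$ and commuting $h_i$ with $h_i\vartheta_j=v_i^{c_{ij}}\vartheta_jh_i$; $h_\alpha=\prod h_i^{a_i}$. Coproduct: $\Delta(\vartheta_i)=\vartheta_i\otimes1+h_i\otimes\vartheta_i$, $\Delta(h_i)=h_i\otimes h_i$. $\varphi$ is the symmetric Hopf pairing ($\varphi(ab,c)=\sum\varphi(a,c_{(1)})\varphi(b,c_{(2)})$, $\varphi(a,bc)=\sum\varphi(a_{(1)},b)\varphi(a_{(2)},c)$) with $\varphi(\vartheta_i,\vartheta_j)=\delta_{ij}(v_i-v_i^{-1})$, $\varphi(h_i,h_j)=v_i^{c_{ij}}$, $\varphi(\vartheta_i,h_j)=0$. $\tau$ acts by $\vartheta_i\mapsto\vartheta_{\tau i}$, $h_i\mapsto h_{\tau i}$. $\widehat{\mathbf B}^\imath_\tau$ is the vector space $\widehat{\mathbf B}$ with the associative product $a*b=\sum\varphi(\tau b_{(2)},a_{(1)})\,a_{(2)}b_{(1)}$. $\iota:\mathbf f\to\widehat{\mathbf B}^\imath_\tau$ is the inclusion of vector spaces. $\mathbb K_\alpha=v^{\frac12(\alpha,\tau\alpha)}h_{\tau\alpha}$. $h_\alpha\diamond x=v^{\frac12(\tau\alpha-\alpha,\mathrm{wt}(x))}h_\alpha*x$ for homogeneous $x$ (with $\mathrm{wt}(h_\alpha)=\alpha+\tau\alpha$), extended linearly in $h_\alpha$. The bar involution is the $\mathbb Q$-algebra anti-involution of $(\widehat{\mathbf B}^\imath_\tau,* )$ with $\overline{v^{1/2}}=v^{-1/2}$,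 $\overline{\vartheta_i}=\vartheta_i$, $\overline{h_\alpha}=v^{(\alpha,\tau\alpha)}h_\alpha$. $\sigma^\imath$ is the $\mathbb Q(v^{1/2})$-linear anti-involution of $(\widehat{\mathbf B}^\imath_\tau,* )$ with $\sigma^\imath(\vartheta_i)=\vartheta_i$, $\sigma^\imath(h_\alpha)=h_{\tau\alpha}$. Dual canonical bases. $\mathbf C^{\mathrm{can}}$ is the Lusztig–Kashiwara canonical basis of $\mathbf f$, $\{b^*\}$ its dual basis with respect to $\varphi|_{\mathbf f\times\mathbf f}$; $\mathrm{ht}(\sum a_i\alpha_i)=\sum d_ia_i$, $\mathtt N(\alpha)=\frac12(\alpha,\alpha)-\mathrm{ht}(\alpha)$, $\mathbf C=\{v^{\frac12\mathtt N(\mathrm{wt}(b))}b^*\mid b\in\mathbf C^{\mathrm{can}}\}$. $C_{\alpha,b}\in\widehat{\mathbf B}^\imath_\tau$ is the unique bar-invariant element with $C_{\alpha,b}\in\mathbb K_\alpha\diamond\iota(b)+\sum_{(\beta,b')\in\mathbb N^{\mathbb I}\times\mathbf C}v^{-1}\mathbb Z[v^{-1}]\,\mathbb K_\beta\diamond\iota(b')$; $C_b=C_{0,b}$, and $C_{\alpha,b}=\mathbb K_\alpha\diamond C_b$. *)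

(* Defs.v *)
From HB Require Import structures.
From mathcomp Require Import all_boot all_order all_algebra all_fingroup.

Set Implicit Arguments.
Unset Strict Implicit.
Unset Printing Implicit Defensive.

Import Order.TTheory GRing.Theory Num.Theory.
Local Open Scope ring_scope.

Definition K : fieldType := {fraction {poly rat}}.

(* The indeterminate of K plays the role of v^{1/2}. *)
Definition vhalf : K := tofrac ('X : {poly rat}).
Definition v : K := vhalf ^+ 2.

Definition vinv_Zvinv (c : K) : Prop :=
  exists p : {poly int}, c = v^-1 * (map_poly intr p).[v^-1].

(* Rational functions in Q(v) that are regular at v = oo, i.e. at v^{-1} = 0. *)
Definition regular_infty (c : K) : Prop :=
  exists p r : {poly rat}, r.[0] != 0 /\
    c = (map_poly ratr p).[v^-1] / (map_poly ratr r).[v^-1].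

Record root_data := RootData {
  nodes :> finType;
  cartan : nodes -> nodes -> int;
  dsym : nodes -> nat;
  tau : {perm nodes};
  cartan_diag : forall i, cartan i i = 2;
  cartan_offdiag : forall i j, i != j -> cartan i j <= 0;
  cartan_eq0 : forall i j, cartan i j = 0 -> cartan j i = 0;
  dsym_gt0 : forall i, (0 < dsym i)%N;
  cartan_sym : forall i j,
    (dsym i)%:Z * cartan i j = (dsym j)%:Z * cartan j i;
  (* finite type: the symmetric matrix DC is positive definite *)
  cartan_finite : forall x : {ffun nodes -> rat}, x != 0 ->
    0 < \sum_i \sum_j x i * ((dsym i)%:Z * cartan i j)%:~R * x j;
  tau_involutive : involutive tau;
  cartan_tau : forall i j, cartan (tau i) (tau j) = cartan i j;
  dsym_tau : forall i, dsym (tau i) = dsym i }.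

Arguments tau : clear implicits.

(* The monoid N^I; its elements are written in the basis of simple roots. *)
Notation weight R := {ffun nodes R -> nat}.

Definition simple_root {R : root_data} (i : R) : weight R :=
  [ffun j => (j == i) : nat].

(* tau (sum_i a_i alpha_i) = sum_i a_i alpha_{tau i} *)
Definition wtau {R : root_data} (al : weight R) : weight R :=
  [ffun j => al ((tau R)^-1%g j)].

Definition form {R : root_data} (al be : weight R) : int :=
  \sum_i \sum_j (al i)%:Z * (be j)%:Z * ((dsym i)%:Z * cartan i j).

Definition ht {R : root_data} (al : weight R) : int :=
  \sum_i (dsym i)%:Z * (al i)%:Z.

(* The division is exact: (alpha, alpha) is even. *)
Definition Nfun {R : root_data} (al : weight R) : int :=
  (form al al %/ 2)%Z - ht al.

Definition vi {R : root_data} (i : R) : K := v ^+ dsym i.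

Definition qint {R : root_data} (i : R) (n : nat) : K :=
  (vi i ^+ n - vi i ^- n) / (vi i - (vi i)^-1).
Definition qfact {R : root_data} (i : R) (n : nat) : K :=
  \prod_(1 <= k < n.+1) qint i k.
Definition qbinom {R : root_data} (i : R) (n k : nat) : K :=
  qfact i n / (qfact i k * qfact i (n - k)).

Inductive generated (J : Type) (A : algType K) (g : J -> A) : A -> Prop :=
| gen_one : generated g 1
| gen_gen j : generated g (g j)
| gen_add x y : generated g x -> generated g y -> generated g (x + y)
| gen_scale a x : generated g x -> generated g (a *: x)
| gen_mul x y : generated g x -> generated g y -> generated g (x * y).

(* [A] is the K-algebra generated by the family [g] subject to the relations
   [rel]; by [generated], the morphism out of [A] is unique. *)
Definition presented (J : Type)
    (rel : forall A : algType K, (J -> A) -> Prop)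
    (A : algType K) (g : J -> A) : Prop :=
  [/\ rel A g,
      forall x, generated g x
    & forall (A' : algType K) (g' : J -> A'), rel A' g' ->
        exists F : {lrmorphism A -> A'}, forall j, F (g j) = g' j].

(* Homogeneous elements of weight [w], for the N^I-grading in which the
   generator [g j] has weight [wt j]. *)
Inductive homogeneous (R : root_data) (J : Type) (A : algType K)
    (g : J -> A) (wt : J -> weight R) : weight R -> A -> Prop :=
| hom_zero w : homogeneous g wt w 0
| hom_one : homogeneous g wt 0 1
| hom_gen j : homogeneous g wt (wt j) (g j)
| hom_add w x y : homogeneous g wt w x -> homogeneous g wt w y ->
    homogeneous g wt w (x + y)
| hom_scale w a x : homogeneous g wt w x -> homogeneous g wt w (a *: x)
| hom_mul w w' x y : homogeneous g wt w x -> homogeneous g wt w' y ->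
    homogeneous g wt (w + w') (x * y).

Definition serre_rel (R : root_data) (A : algType K) (x : R -> A) : Prop :=
  forall i j, i != j -> let m := `|1 - cartan i j|%N in
    \sum_(k < m.+1) ((-1) ^+ k * qbinom i m k) *:
      (x i ^+ k * x j * x i ^+ (m - k)) = 0.

(* [vtheta] are the generators normalized so that
   vtheta_i = (v_i - v_i^{-1}) theta_i with theta_i those of Lusztig. *)
Definition theta_of (R : root_data) (A : algType K) (vtheta : R -> A) (i : R)
  : A := (vi i - (vi i)^-1)^-1 *: vtheta i.

Record falgebra (R : root_data) := FAlgebra {
  f_alg :> algType K;
  vtheta : R -> f_alg;
  f_presented : presented (@serre_rel R) vtheta;
  sigma : f_alg -> f_alg;
  sigma_linear : linear sigma;
  sigma_one : sigma 1 = 1;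
  sigma_mul : forall x y, sigma (x * y) = sigma y * sigma x;
  sigma_invol : involutive sigma;
  sigma_vtheta : forall i, sigma (vtheta i) = vtheta i;
  (* Lusztig's bar involution of f; it fixes theta_i, hence negates vtheta_i *)
  psi : f_alg -> f_alg;
  psi_add : forall x y, psi (x + y) = psi x + psi y;
  psi_one : psi 1 = 1;
  psi_mul : forall x y, psi (x * y) = psi x * psi y;
  psi_invol : involutive psi;
  psi_vhalf : psi vhalf%:A = (vhalf^-1)%:A;
  psi_theta : forall i, psi (theta_of vtheta i) = theta_of vtheta i;
  (* Kashiwara's skew derivations e'_i (Lusztig's {}_i r) *)
  eprime : R -> f_alg -> f_alg;
  eprime_linear : forall i, linear (eprime i);
  eprime_one : forall i, eprime i 1 = 0;
  eprime_theta : forall i j x,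
    eprime i (theta_of vtheta j * x) =
      (i == j)%:R *: x + v ^ form (simple_root i) (simple_root j) *:
        (theta_of vtheta j * eprime i x) }.

Definition theta {R : root_data} {F : falgebra R} (i : R) : F :=
  theta_of (@vtheta R F) i.

Definition div_power {R : root_data} {F : falgebra R} (i : R) (n : nat) : F :=
  (qfact i n)^-1 *: theta i ^+ n.

Definition homf {R : root_data} {F : falgebra R} (w : weight R) (x : F) : Prop :=
  homogeneous (@vtheta R F) simple_root w x.

(* The graph of Kashiwara's operator ~f_i:
   sum_n theta_i^{(n)} u_n  |->  sum_n theta_i^{(n+1)} u_n   with e'_i u_n = 0 *)
Definition kashiwara_f {R : root_data} {F : falgebra R} (i : R) (x y : F)
  : Prop :=
  exists (m : nat) (u : nat -> F),
    [/\ forall n, eprime i (u n) = 0,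
        x = \sum_(n < m) div_power i n * u n
      & y = \sum_(n < m) div_power i n.+1 * u n].

Inductive crystal_element {R : root_data} {F : falgebra R} : F -> Prop :=
| crystal_one : crystal_element 1
| crystal_step i x y :
    crystal_element x -> kashiwara_f i x y -> crystal_element y.

(* Kashiwara's lattice L(oo); his q is v^{-1} *)
Inductive crystal_lattice {R : root_data} {F : falgebra R} : F -> Prop :=
| lattice_zero : crystal_lattice 0
| lattice_add c x y : regular_infty c -> crystal_element x ->
    crystal_lattice y -> crystal_lattice (c *: x + y).

Inductive integral_form {R : root_data} {F : falgebra R} : F -> Prop :=
| int_one : integral_form 1
| int_div_power i n : integral_form (div_power i n)
| int_sub x y : integral_form x -> integral_form y -> integral_form (x - y)
| int_mul x y : integral_form x -> integral_form y -> integral_form (x * y)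
| int_v x : integral_form x -> integral_form (v *: x)
| int_vinv x : integral_form x -> integral_form (v^-1 *: x).

(* The canonical (lower global crystal) basis: the bar-invariant elements of
   the integral form that are congruent, modulo v^{-1} L(oo), to an element of
   the crystal basis B(oo) *)
Definition canonical {R : root_data} {F : falgebra R} (b : F) : Prop :=
  [/\ integral_form b, psi b = b
    & exists y z, [/\ crystal_element y, crystal_lattice z
                    & b = y + v^-1 *: z]].

Definition extend_gens (J J' A : Type) (x : J -> A) (y : J' -> A) (j : J + J')
  : A := match j with inl i => x i | inr i => y i end.

(* The generators indexed by [inl i] are the vtheta_i, those indexed by
   [inr i] are the h_i; the h_i are not inverted. *)
Definition Bhat_rel (R : root_data) (A : algType K) (g : R + R -> A) : Prop :=
  let x := fun i => g (inl i) in let h := fun i => g (inr i) in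
  [/\ serre_rel x,
      forall i j, h i * h j = h j * h i
    & forall i j, h i * x j = vi i ^ cartan i j *: (x j * h i)].

(* An element of A (x) A is represented by a list of pure tensors; two lists
   represent the same element iff no bilinear map separates them. *)
Definition tensor_eq (A : algType K) (s t : seq (A * A)) : Prop :=
  forall (W : lmodType K) (be : A -> A -> W),
    (forall x, linear (be x)) -> (forall y, linear (be^~ y)) ->
    \sum_(p <- s) be p.1 p.2 = \sum_(p <- t) be p.1 p.2.

Record Bhat (R : root_data) (F : falgebra R) := MkBhat {
  B_alg :> algType K;
  iota : {lrmorphism F -> B_alg};
  hgen : R -> B_alg;
  B_presented : presented (@Bhat_rel R)
    (extend_gens (fun i => iota (vtheta F i)) hgen);
  (* the coproduct, as a choice of a representative
     Delta x = sum x_(1) (x) x_(2) *)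
  Delta : B_alg -> seq (B_alg * B_alg);
  Delta_linear : forall a x y,
    tensor_eq (Delta (a *: x + y))
      ([seq (a *: p.1, p.2) | p <- Delta x] ++ Delta y);
  Delta_one : tensor_eq (Delta 1) [:: (1, 1)];
  Delta_mul : forall x y,
    tensor_eq (Delta (x * y))
      [seq (p.1 * r.1, p.2 * r.2) | p <- Delta x, r <- Delta y];
  Delta_vtheta : forall i,
    tensor_eq (Delta (iota (vtheta F i)))
      [:: (iota (vtheta F i), 1); (hgen i, iota (vtheta F i))];
  Delta_h : forall i, tensor_eq (Delta (hgen i)) [:: (hgen i, hgen i)];
  phi : B_alg -> B_alg -> K;
  phi_linear : forall x, scalar (phi x);
  phi_sym : forall x y, phi x y = phi y x;
  phi_one : phi 1 1 = 1;
  phi_mull : forall a b c,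
    phi (a * b) c = \sum_(p <- Delta c) phi a p.1 * phi b p.2;
  phi_mulr : forall a b c,
    phi a (b * c) = \sum_(p <- Delta a) phi p.1 b * phi p.2 c;
  phi_vtheta : forall i j,
    phi (iota (vtheta F i)) (iota (vtheta F j)) =
      (i == j)%:R * (vi i - (vi i)^-1);
  phi_h : forall i j, phi (hgen i) (hgen j) = vi i ^ cartan i j;
  phi_vtheta_h : forall i j, phi (iota (vtheta F i)) (hgen j) = 0;
  tauB : {lrmorphism B_alg -> B_alg};
  tauB_vtheta : forall i,
    tauB (iota (vtheta F i)) = iota (vtheta F (tau R i));
  tauB_h : forall i, tauB (hgen i) = hgen (tau R i) }.

Definition hmon {R : root_data} {F : falgebra R} (B : Bhat F) (al : weight R)
  : B := \prod_i hgen B i ^+ al i.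

Definition star {R : root_data} {F : falgebra R} {B : Bhat F} (a b : B) : B :=
  \sum_(p <- Delta a) \sum_(r <- Delta b)
    phi (tauB B r.2) p.1 *: (p.2 * r.1).

Definition homB {R : root_data} {F : falgebra R} {B : Bhat F}
    (w : weight R) (x : B) : Prop :=
  homogeneous (extend_gens (fun i => iota B (vtheta F i)) (hgen B))
    (extend_gens simple_root
       (fun i => simple_root i + simple_root (tau R i))) w x.

(* The structure maps of the iHopf algebra (B, star). Only their values on
   generators and their compatibility with star are recorded; these determine
   them uniquely. *)
Record iHopf (R : root_data) (F : falgebra R) (B : Bhat F) := MkIHopf {
  (* h_al <> x, extended from homogeneous x (hdiam_hom) to all x by linearity *)
  hdiam : weight R -> B -> B;
  hdiam_linear : forall al, linear (hdiam al);
  hdiam_hom : forall al w x, homB w x ->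
    hdiam al x = vhalf ^ (form (wtau al) w - form al w) *: star (hmon B al) x;
  bar : B -> B;
  bar_add : forall x y, bar (x + y) = bar x + bar y;
  bar_one : bar 1 = 1;
  bar_star : forall x y, bar (star x y) = star (bar y) (bar x);
  bar_invol : involutive bar;
  bar_vhalf : bar vhalf%:A = (vhalf^-1)%:A;
  bar_vtheta : forall i, bar (iota B (vtheta F i)) = iota B (vtheta F i);
  bar_h : forall al, bar (hmon B al) = v ^ form al (wtau al) *: hmon B al;
  sigma_i : B -> B;
  sigma_i_linear : linear sigma_i;
  sigma_i_one : sigma_i 1 = 1;
  sigma_i_star : forall x y,
    sigma_i (star x y) = star (sigma_i y) (sigma_i x);
  sigma_i_invol : involutive sigma_i;
  sigma_i_vtheta : forall i,
    sigma_i (iota B (vtheta F i)) = iota B (vtheta F i);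
  sigma_i_h : forall al, sigma_i (hmon B al) = hmon B (wtau al) }.

(* K_al <> x, where K_al = v^{(al, tau al)/2} h_{tau al} *)
Definition Kdiam {R : root_data} {F : falgebra R} {B : Bhat F} (H : iHopf B)
    (al : weight R) (x : B) : B :=
  vhalf ^ form al (wtau al) *: hdiam H (wtau al) x.

(* The set C: [bs] is b^*, the element of the dual basis attached to [b] *)
Definition dual_canonical {R : root_data} {F : falgebra R} (B : Bhat F) (x : F)
  : Prop :=
  exists (w : weight R) (b bs : F),
    [/\ canonical b, homf w b,
        forall b', canonical b' ->
          phi (iota B bs) (iota B b') = (b' == b)%:R
      & x = vhalf ^ Nfun w *: bs].

Definition dual_ican {R : root_data} {F : falgebra R} {B : Bhat F}
    (H : iHopf B) (al : weight R) (b : F) (x : B) : Prop :=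
  bar H x = x /\
  exists s : seq (K * (weight R * F)),
    (forall t, t \in s -> vinv_Zvinv t.1 /\ dual_canonical B t.2.2) /\
    x = Kdiam H al (iota B b) +
        \sum_(t <- s) t.1 *: Kdiam H t.2.1 (iota B t.2.2).

Definition preserved (T : Type) (g : T -> T) (P : T -> Prop) : Prop :=
  forall y, P y <-> exists2 x, P x & y = g x.

(* Main.v *)
(** Contracting the coproduct of [x] against a fixed element turns the product
    of the iHopf algebra into ordinary multiplication: a grouplike [h_al] gives
    [h_al * x = h_al L(x)] and [x * h_al = R(x) h_al] with [L], [R] algebra
    morphisms scaling homogeneous elements, while [vtheta_i] gives skew
    derivations.  Hence [x * h_al] is a power of [v] times [h_al * x] on weight
    spaces, [K_al <>] commutes with the bar involution, and
    [K_al <> K_be <> x = K_{al+be} <> x].  The left and right skew derivations of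
    a word in the [vtheta_i] are exchanged by [sigma] up to the scaling [R], and
    induction on the length of the word yields
    [sigma_i (iota x) = iota (sigma x)], hence
    [sigma_i (K_al <> iota x) = K_{tau al} <> iota (sigma x)].  Since [sigma_i]
    also commutes with the bar involution, the characterization of [C_{al,b}]
    is carried to that of [C_{tau al, sigma b}].

    The definition of [dual_canonical] does not make [bs] homogeneous, so every
    identity is proved on all of [F] or [B], by linearity from the weight
    spaces. *)
From mathcomp Require Import all_boot all_order all_algebra all_fingroup.
From mathcomp Require Import generic_quotient ring zify.
Require Import Defs.

Set Implicit Arguments.
Unset Strict Implicit.
Unset Printing Implicit Defensive.

Import Order.TTheory GRing.Theory Num.Theory.
Local Open Scope ring_scope.

(** * Weights, the twist by [tau] and the symmetric form *)

Section Weights.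
Variable R : root_data.
Implicit Types al be ga : weight R.

(** A nonzero weight has a positive coefficient, so a simple root can be subtracted from it; the
    induction is on the sum of the coefficients. *)
Lemma weight_ind (P : weight R -> Prop) :
  P 0 -> (forall i al, P al -> P (simple_root i + al)) -> forall al, P al.
Proof.
move=> P0 PS al; have [n] := ubnP (\sum_i al i)%N.
elim: n al => // n IHn al ltn.
case: (pickP (fun i => al i != 0%N)) => [i ali | al0]; last first.
  by rewrite (_ : al = 0) //; apply/ffunP=> i; rewrite ffunE; apply/eqP/negPn; rewrite al0.
pose be : weight R := [ffun j => (al j - (j == i))%N].
have def_al : al = simple_root i + be.
  apply/ffunP=> j; rewrite !ffunE natrDE subnKC //.
  by case: eqP => // ->; rewrite lt0n.
rewrite def_al; apply/PS/IHn; apply: leq_trans (_ : (\sum_i al i <= n)%N); last by [].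
rewrite [X in (_ < X)%N](eq_bigr (fun j => (simple_root i j + be j)%N)); last first.
  by move=> j _; rewrite {1}def_al ffunE.
rewrite big_split /= -[X in (X < _)%N]add0n ltn_add2r.
by rewrite (bigD1 i) //= ffunE eqxx.
Qed.

Lemma tauV i : (tau R)^-1%g i = tau R i.
Proof. by apply: (@perm_inj _ (tau R)); rewrite permKV tau_involutive. Qed.

Lemma wtauD al be : wtau (al + be) = wtau al + wtau be.
Proof. by apply/ffunP=> i; rewrite !ffunE. Qed.

Lemma wtau0 : wtau 0 = 0 :> weight R.
Proof. by apply/ffunP=> i; rewrite !ffunE. Qed.

Lemma wtauK : involutive (@wtau R).
Proof. by move=> al; apply/ffunP=> i; rewrite !ffunE !tauV tau_involutive. Qed.

Lemma wtau_simple i : wtau (simple_root i) = simple_root (tau R i).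
Proof.
apply/ffunP=> j; rewrite !ffunE tauV; congr (nat_of_bool _).
by rewrite (can2_eq (@tau_involutive R) (@tau_involutive R)).
Qed.

Lemma formDl al be ga : form (al + be) ga = form al ga + form be ga.
Proof.
rewrite /form -big_split /=; apply: eq_bigr => i _.
rewrite -big_split /=; apply: eq_bigr => j _.
by rewrite ffunE PoszD !mulrDl.
Qed.

Lemma formC al be : form al be = form be al.
Proof.
rewrite /form exchange_big /=; apply: eq_bigr => i _; apply: eq_bigr => j _.
by rewrite cartan_sym [(al j)%:Z * _]mulrC.
Qed.

Lemma formDr al be ga : form ga (al + be) = form ga al + form ga be.
Proof. by rewrite formC formDl !(formC ga). Qed.

Lemma form0l al : form 0 al = 0.
Proof. by rewrite /form big1 // => i _; rewrite big1 // => j _; rewrite ffunE !mul0r. Qed.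

Lemma form0r al : form al 0 = 0.
Proof. by rewrite formC form0l. Qed.

Lemma form_simple (i j : R) :
  form (simple_root i) (simple_root j) = (dsym i)%:Z * cartan i j.
Proof.
rewrite /form (bigD1 i) //= (bigD1 j) //= !ffunE !eqxx mul1r !big1 ?addr0 ?mul1r //.
  by move=> k /negPf ki; rewrite big1 // => l _; rewrite !ffunE ki /= !mul0r.
by move=> k /negPf ki; rewrite !ffunE ki /= mulr0 mul0r.
Qed.

Lemma form_wtau al be : form (wtau al) (wtau be) = form al be.
Proof.
rewrite /form (reindex_perm (tau R)) /=; apply: eq_bigr => i _.
rewrite (reindex_perm (tau R)) /=; apply: eq_bigr => j _.
by rewrite !ffunE !permK dsym_tau cartan_tau.
Qed.

Lemma form_wtaul al be : form (wtau al) be = form al (wtau be).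
Proof. by rewrite -[be in LHS]wtauK form_wtau. Qed.

End Weights.

(** * Consequences of the unbundled predicate [linear] *)

Section LinearMaps.
Variables (U V : lmodType K) (f : U -> V).
Hypothesis fL : linear f.

Lemma linear_map0 : f 0 = 0.
Proof. by have := fL (-1) 0 0; rewrite !scaleN1r oppr0 addr0 addNr. Qed.

Lemma linear_mapD x y : f (x + y) = f x + f y.
Proof. by have := fL 1 x y; rewrite !scale1r. Qed.

Lemma linear_mapZ a x : f (a *: x) = a *: f x.
Proof. by have := fL a x 0; rewrite linear_map0 !addr0. Qed.

Lemma linear_mapB x y : f (x - y) = f x - f y.
Proof. by rewrite linear_mapD -[- y]scaleN1r linear_mapZ scaleN1r. Qed.

Lemma linear_map_sum (I : Type) (r : seq I) (G : I -> U) :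
  f (\sum_(i <- r) G i) = \sum_(i <- r) f (G i).
Proof. exact: (big_morph f linear_mapD linear_map0). Qed.

End LinearMaps.

Lemma linear_sum_fun (U V : lmodType K) (I : Type) (r : seq I) (G : I -> U -> V) :
  (forall i, linear (G i)) -> linear (fun x => \sum_(i <- r) G i x).
Proof.
move=> GL a x y; rewrite scaler_sumr -big_split /=.
by apply: eq_bigr => i _; rewrite GL.
Qed.

(** * Contractions of the coproduct and the product [star] *)

Section Sweedler.
Variables (R : root_data) (F : falgebra R) (B : Bhat F).
Implicit Types (x y a b c g : B) (i j : R) (al be : weight R).

(** [Delta] is a chosen representative of a tensor, known up to [tensor_eq]; a sum over it does not
    depend on the choice once the summand is bilinear. *)
Definition bilinear_map (W : lmodType K) (f : B -> B -> W) :=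
  (forall x, linear (f x)) /\ (forall y, linear (f^~ y)).

Lemma tensor_eqE (W : lmodType K) (f : B -> B -> W) s t :
  bilinear_map f -> tensor_eq s t ->
  \sum_(p <- s) f p.1 p.2 = \sum_(p <- t) f p.1 p.2.
Proof. by case=> fr fl; apply. Qed.

Lemma DeltaM_sum (W : lmodType K) (f : B -> B -> W) x y : bilinear_map f ->
  \sum_(p <- Delta (x * y)) f p.1 p.2 =
  \sum_(p <- Delta x) \sum_(r <- Delta y) f (p.1 * r.1) (p.2 * r.2).
Proof. by move=> fb; rewrite (tensor_eqE fb (Delta_mul x y)) big_allpairs_dep. Qed.

Lemma Delta_sum_linear (W : lmodType K) (f : B -> B -> W) : bilinear_map f ->
  linear (fun x => \sum_(p <- Delta x) f p.1 p.2).
Proof.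
move=> fb a x y; rewrite (tensor_eqE fb (Delta_linear a x y)) big_cat big_map /=.
rewrite scaler_sumr; congr (_ + _); apply: eq_bigr => p _.
by have [_ fl] := fb; rewrite (linear_mapZ (fl _)).
Qed.

Lemma phiDr a : linear (phi a : B -> K^o).
Proof. exact: phi_linear. Qed.

Lemma phiDl b : linear (fun a => phi a b : K^o).
Proof. by move=> c x y; rewrite !(phi_sym _ b) phiDr. Qed.

Definition grouplike g := tensor_eq (Delta g) [:: (g, g)].

Lemma phiM a b c t : tensor_eq (Delta a) t ->
  phi a (b * c) = \sum_(p <- t) phi p.1 b * phi p.2 c.
Proof.
move=> tP; rewrite phi_mulr.
apply: (@tensor_eqE K^o (fun x y => phi x b * phi y c)) tP; split=> x k y z /=.
  by rewrite (phiDl c k y z) mulrDr; congr (_ + _); apply: mulrCA.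
by rewrite (phiDl b k y z) mulrDl; congr (_ + _); rewrite -mulrA.
Qed.

(** Expanding [star a b] along its left factor produces [contrl] against a_(1), applied to [b];
    expanding along its right factor produces [contrr] against tau b_(2), applied to [a]. *)
Definition contrl g x : B := \sum_(p <- Delta x) phi (tauB B p.2) g *: p.1.
Definition contrr g x : B := \sum_(p <- Delta x) phi g p.1 *: p.2.

Lemma contrl_bilinear g : bilinear_map (fun a b => phi (tauB B b) g *: a).
Proof.
split=> x k y z; last by rewrite scalerDr scalerA mulrC -scalerA.
by rewrite linearP (phiDl g k) scalerDl -scalerA.
Qed.

Lemma contrr_bilinear g : bilinear_map (fun a b : B => phi g a *: b).
Proof.
split=> x k y z; first by rewrite scalerDr scalerA mulrC -scalerA.
by rewrite (phiDr g k) scalerDl -scalerA.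
Qed.

Lemma contrlE g x t : tensor_eq (Delta x) t ->
  contrl g x = \sum_(p <- t) phi (tauB B p.2) g *: p.1.
Proof. exact: tensor_eqE (contrl_bilinear g). Qed.

Lemma contrrE g x t : tensor_eq (Delta x) t ->
  contrr g x = \sum_(p <- t) phi g p.1 *: p.2.
Proof. exact: tensor_eqE (contrr_bilinear g). Qed.

Lemma contrl_linear g : linear (contrl g).
Proof. exact: Delta_sum_linear (contrl_bilinear g). Qed.

Lemma contrr_linear g : linear (contrr g).
Proof. exact: Delta_sum_linear (contrr_bilinear g). Qed.

Lemma contrl_linear_l x : linear (contrl^~ x).
Proof.
apply: linear_sum_fun => p k y z.
by rewrite (phiDr (tauB B p.2) k) scalerDl -scalerA.
Qed.

Lemma contrr_linear_l x : linear (contrr^~ x).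
Proof.
by apply: linear_sum_fun => p k y z; rewrite (phiDl p.1 k) scalerDl -scalerA.
Qed.

(** The pairing of a product with [g] splits along the coproduct of [g]. A grouplike [g] therefore
    contracts by an algebra morphism, and [vtheta_i] by a skew derivation. *)
Lemma contrlM g x y t : tensor_eq (Delta g) t ->
  contrl g (x * y) = \sum_(q <- t) contrl q.1 x * contrl q.2 y.
Proof.
move=> tP; rewrite /contrl (DeltaM_sum _ _ (contrl_bilinear g)).
under eq_bigr => p _ do under eq_bigr => r _ do
  rewrite rmorphM phi_sym (phiM _ _ tP) scaler_suml.
under [RHS]eq_bigr => q _ do rewrite mulr_suml.
under [RHS]eq_bigr => q _ do under eq_bigr => p _ do rewrite mulr_sumr.
rewrite [RHS]exchange_big /=; apply: eq_bigr => p _.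
rewrite [RHS]exchange_big /=; apply: eq_bigr => r _.
apply: eq_bigr => q _.
by rewrite -scalerAl -scalerAr scalerA (phi_sym q.1) (phi_sym q.2).
Qed.

Lemma contrrM g x y t : tensor_eq (Delta g) t ->
  contrr g (x * y) = \sum_(q <- t) contrr q.1 x * contrr q.2 y.
Proof.
move=> tP; rewrite /contrr (DeltaM_sum _ _ (contrr_bilinear g)).
under eq_bigr => p _ do under eq_bigr => r _ do
  rewrite (phiM _ _ tP) scaler_suml.
under [RHS]eq_bigr => q _ do rewrite mulr_suml.
under [RHS]eq_bigr => q _ do under eq_bigr => p _ do rewrite mulr_sumr.
rewrite [RHS]exchange_big /=; apply: eq_bigr => p _.
rewrite [RHS]exchange_big /=; apply: eq_bigr => r _.
apply: eq_bigr => q _.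
by rewrite -scalerAl -scalerAr scalerA.
Qed.

Lemma star_contrl a b t : tensor_eq (Delta a) t ->
  star a b = \sum_(p <- t) p.2 * contrl p.1 b.
Proof.
move=> tP; rewrite -(tensor_eqE (f := fun p1 p2 => p2 * contrl p1 b) _ tP).
  rewrite /star; apply: eq_bigr => p _; rewrite /contrl mulr_sumr.
  by apply: eq_bigr => r _; rewrite scalerAr.
split=> x k y z; first by rewrite mulrDl -scalerAl.
by rewrite contrl_linear_l mulrDr -scalerAr.
Qed.

Lemma star_contrr a b t : tensor_eq (Delta b) t ->
  star a b = \sum_(r <- t) contrr (tauB B r.2) a * r.1.
Proof.
move=> tP; rewrite -(tensor_eqE (f := fun r1 r2 => contrr (tauB B r2) a * r1) _ tP).
  rewrite /star exchange_big; apply: eq_bigr => r _; rewrite /contrr mulr_suml.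
  by apply: eq_bigr => p _; rewrite scalerAl.
split=> x k y z; last by rewrite mulrDr -scalerAr.
by rewrite linearP contrr_linear_l mulrDl -scalerAl.
Qed.

Lemma tensor_eq_refl (s : seq (B * B)) : tensor_eq s s.
Proof. by []. Qed.

Lemma star_linear a : linear (star a : B -> B).
Proof.
move=> k x y; rewrite !(star_contrl _ (tensor_eq_refl (Delta a))).
rewrite scaler_sumr -big_split; apply: eq_bigr => p _ /=.
by rewrite contrl_linear mulrDr scalerAr.
Qed.

Lemma star_linear_l b : linear (star^~ b : B -> B).
Proof.
move=> k x y; rewrite !(star_contrr _ (tensor_eq_refl (Delta b))).
rewrite scaler_sumr -big_split; apply: eq_bigr => p _ /=.
by rewrite contrr_linear mulrDl scalerAl.
Qed.

End Sweedler.

(** * Fractions and powers of [v] in the ground field *)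

Lemma fraction_num_den (D : idomainType) (a : {fraction D}) :
  exists n d : D, d != 0 /\ a = tofrac n / tofrac d.
Proof.
elim/quotW: a => r; have d_neq0 := denom_ratioP r.
exists (frac r).1, (frac r).2; split=> //.
(* Clearing the denominator leaves an identity between representatives in the quotient that defines
   the fraction field. *)
apply: (mulIf (x := tofrac (frac r).2)); first by rewrite tofrac_eq0.
rewrite divfK ?tofrac_eq0 // ![tofrac _]piE -[LHS]FracField.pi_mul.
apply/eqmodP; rewrite /= FracField.equivfE /FracField.mulf.
by rewrite !numden_Ratio ?mulf_neq0 ?oner_neq0 // !mulr1 mulrC.
Qed.

Lemma vhalf_neq0 : vhalf != 0.
Proof. by rewrite tofrac_eq0 polyX_eq0. Qed.

Lemma v_neq0 : v != 0.
Proof. by rewrite expf_neq0 ?vhalf_neq0. Qed.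

Lemma exprvD (m n : int) : v ^ (m + n) = v ^ m * v ^ n.
Proof. exact: expfzDr v_neq0. Qed.

Lemma v_expz_neq0 (n : int) : v ^ n != 0.
Proof. exact: expfz_neq0 v_neq0. Qed.

Lemma vi_expz (R : root_data) (i j : R) :
  vi i ^ cartan i j = v ^ form (simple_root i) (simple_root j).
Proof. by rewrite form_simple /vi exprnP exprz_exp. Qed.

(** * Induction principles for a graded algebra *)

Section Graded.
Variables (R : root_data) (J : Type) (A : algType K) (g : J -> A).
Variable wt : J -> weight R.

Lemma homogeneous_left_ind (P : weight R -> A -> Prop) :
  (forall w, P w 0) -> P 0 1 ->
  (forall w x y, P w x -> P w y -> P w (x + y)) ->
  (forall w a x, P w x -> P w (a *: x)) ->
  (forall j w x, P w x -> P (wt j + w) (g j * x)) ->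
  forall w x, homogeneous g wt w x -> P w x.
Proof.
move=> P0 P1 PD PZ PM.
(* Products of arbitrary homogeneous elements are handled by proving that left multiplication by [x]
   preserves [P]; the claim is this applied to 1. *)
suff IH w x : homogeneous g wt w x -> forall w' y, P w' y -> P (w + w') (x * y).
  by move=> w x hx; rewrite -[w]addr0 -[x]mulr1; apply: IH.
elim=> {w x} [w | | j | w x y _ IHx _ IHy | w a x _ IHx | w1 w2 x y _ IHx _ IHy] w' z Pz.
- by rewrite mul0r.
- by rewrite add0r mul1r.
- exact: PM.
- by rewrite mulrDl; apply: PD; [apply: IHx | apply: IHy].
- by rewrite -scalerAl; apply/PZ/IHx.
- by rewrite -addrA -mulrA; apply/IHx/IHy.
Qed.

Lemma homogeneous_spans (P : A -> Prop) :
  (forall x, generated g x) ->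
  P 0 -> (forall x y, P x -> P y -> P (x + y)) ->
  (forall w x, homogeneous g wt w x -> P x) -> forall x, P x.
Proof.
move=> gen P0 PD Phom.
(* Finite sums of homogeneous elements contain the generators and are closed under the algebra
   operations, so they exhaust [A]. *)
pose hom_sum x := exists2 s : seq (weight R * A),
  {in s, forall p, homogeneous g wt p.1 p.2} & x = \sum_(p <- s) p.2.
suff sumP x : hom_sum x.
  move=> x; have [s hs ->] := sumP x; rewrite big_seq.
  by apply: big_ind => // p /hs; apply: Phom.
have hom1 w y : homogeneous g wt w y -> hom_sum y.
  move=> hy; exists [:: (w, y)]; last by rewrite big_seq1.
  by move=> p; rewrite inE => /eqP->.
elim: (gen x) => {x} [| j | x y _ [s hs ->] _ [t ht ->]
  | a x _ [s hs ->] | x y _ [s hs ->] _ [t ht ->]].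
- by apply: hom1; apply: hom_one.
- by apply: hom1; apply: hom_gen.
- exists (s ++ t); last by rewrite big_cat.
  by move=> p; rewrite mem_cat => /orP[/hs | /ht].
- exists [seq (p.1, a *: p.2) | p <- s]; last by rewrite big_map scaler_sumr.
  by move=> p /mapP[q /hs hq ->]; apply: hom_scale.
- exists [seq (p.1 + q.1, p.2 * q.2) | p <- s, q <- t].
    by move=> p /allpairsP[[q r] /= [/hs hq /ht hr ->]]; apply: hom_mul.
  rewrite big_allpairs_dep mulr_suml; apply: eq_bigr => p _.
  by rewrite mulr_sumr.
Qed.

End Graded.

(** * Contractions against generators and the resulting formulas for [star] *)

Section IHopfProduct.
Variables (R : root_data) (F : falgebra R) (B : Bhat F).
Implicit Types (x y : B) (i j : R) (al be w : weight R).
Local Notation th i := (iota B (vtheta F i)).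
Local Notation h := (hgen B).
Local Notation hm := (hmon B).

Lemma Bhat_h_comm i j : h i * h j = h j * h i.
Proof. by case: (B_presented B) => -[_ hC _] _ _; apply: hC. Qed.

Lemma Bhat_h_th i j :
  h i * th j = v ^ form (simple_root i) (simple_root j) *: (th j * h i).
Proof. by case: (B_presented B) => -[_ _ hth] _ _; rewrite -vi_expz; apply: hth. Qed.

Lemma hmon0 : hm 0 = 1.
Proof. by rewrite /hmon big1 // => i _; rewrite ffunE. Qed.

Lemma hmonD al be : hm (al + be) = hm al * hm be.
Proof.
rewrite /hmon -prodrM_comm; first by apply: eq_bigr => i _; rewrite ffunE exprD.
by move=> i j _ _; apply/commrX/commr_sym/commrX/Bhat_h_comm.
Qed.

Lemma hmon_simple i : hm (simple_root i) = h i.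
Proof.
rewrite /hmon (eq_bigr (fun j => if j == i then h j else 1)); last first.
  by move=> j _; rewrite ffunE; case: eqP.
by rewrite -big_mkcond big_pred1_eq.
Qed.

Lemma hmonS i al : hm (simple_root i + al) = h i * hm al.
Proof. by rewrite hmonD hmon_simple. Qed.

Lemma tauB_hmon al : tauB B (hm al) = hm (wtau al).
Proof.
elim/weight_ind: al => [|i al IH]; first by rewrite wtau0 hmon0 rmorph1.
by rewrite wtauD wtau_simple !hmonS rmorphM /= IH tauB_h.
Qed.

Lemma hmon_th al j :
  hm al * th j = v ^ form al (simple_root j) *: (th j * hm al).
Proof.
elim/weight_ind: al => [|i al IH].
  by rewrite hmon0 form0l expr0z mulr1 mul1r scale1r.
rewrite hmonS -mulrA IH -scalerAr [in LHS]mulrA Bhat_h_th -scalerAl scalerA -mulrA.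
by rewrite formDl exprvD mulrC.
Qed.

Lemma grouplike1 : grouplike (1 : B).
Proof. exact: Delta_one. Qed.

Lemma grouplikeM x y : grouplike x -> grouplike y -> grouplike (x * y).
Proof.
move=> gx gy W f fr fl; have fb : bilinear_map f by [].
rewrite (DeltaM_sum _ _ fb) big_seq1 /=.
rewrite (tensor_eqE (f := fun a b => \sum_(r <- Delta y) f (a * r.1) (b * r.2)) _ gx).
  rewrite big_seq1 (tensor_eqE (f := fun a b => f (x * a) (x * b)) _ gy) ?big_seq1 //.
  by split=> a k b c; rewrite mulrDr -scalerAr ?fr ?fl.
split=> a; apply: linear_sum_fun => r k b c; rewrite mulrDl -scalerAl ?fr //.
by rewrite [LHS]fl.
Qed.

Lemma grouplike_hmon al : grouplike (hm al).
Proof.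
elim/weight_ind: al => [|i al IH]; first by rewrite hmon0; apply: grouplike1.
by rewrite hmonS; apply: grouplikeM IH; apply: Delta_h.
Qed.

(** Pairing [h i] with 1 [h i] multiplies the nonzero value [phi (h i) (h i)] by [phi (h i) 1],
    which must then be 1. *)
Lemma phi_h_1 i : phi (h i) 1 = 1.
Proof.
have nz : phi (h i) (h i) != 0 by rewrite phi_h vi_expz v_expz_neq0.
apply: (mulIf nz); rewrite mul1r -[X in _ = phi _ X](mul1r (h i)).
by rewrite (phiM _ _ (@Delta_h _ _ B i)) big_seq1.
Qed.

(** Pairing with 1 = 1 1 through the two-term coproduct gives a value equal to its own double. *)
Lemma phi_th_1 i : phi (th i) 1 = 0.
Proof.
have := phiM 1 1 (@Delta_vtheta _ _ B i); rewrite mulr1 big_cons big_seq1 /=.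
rewrite phi_h_1 phi_one mul1r mulr1 -[LHS]addr0 => /addrI.
by move->.
Qed.

Lemma phi_h_hmon i al : phi (h i) (hm al) = v ^ form (simple_root i) al.
Proof.
elim/weight_ind: al => [|j al IH]; first by rewrite hmon0 form0r phi_h_1.
by rewrite hmonS (phiM _ _ (@Delta_h _ _ B i)) big_seq1 /= IH phi_h vi_expz formDr exprvD.
Qed.

Lemma phi_1_hmon al : phi 1 (hm al) = 1.
Proof.
elim/weight_ind: al => [|j al IH]; first by rewrite hmon0 phi_one.
by rewrite hmonS (phiM _ _ grouplike1) big_seq1 /= IH phi_sym phi_h_1 mulr1.
Qed.

Lemma phi_th_hmon i al : phi (th i) (hm al) = 0.
Proof.
elim/weight_ind: al => [|j al IH]; first by rewrite hmon0 phi_th_1.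
rewrite hmonS (phiM _ _ (@Delta_vtheta _ _ B i)) big_cons big_seq1 /= IH.
by rewrite phi_vtheta_h mul0r mulr0 addr0.
Qed.

Lemma contrl_hmonM al x y :
  contrl (hm al) (x * y) = contrl (hm al) x * contrl (hm al) y.
Proof. by rewrite (contrlM _ _ (grouplike_hmon al)) big_seq1. Qed.

Lemma contrr_hmonM al x y :
  contrr (hm al) (x * y) = contrr (hm al) x * contrr (hm al) y.
Proof. by rewrite (contrrM _ _ (grouplike_hmon al)) big_seq1. Qed.

Lemma contrl_hmon_1 al : contrl (hm al) 1 = 1.
Proof. by rewrite (contrlE _ grouplike1) big_seq1 rmorph1 phi_1_hmon scale1r. Qed.

Lemma contrr_hmon_1 al : contrr (hm al) 1 = 1.
Proof. by rewrite (contrrE _ grouplike1) big_seq1 phi_sym phi_1_hmon scale1r. Qed.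

(** Of the coproduct of vtheta_j, [contrl] retains the term in which [hm al] is paired with 1,
    whereas [contrr] retains the one in which it is paired with [h j]; hence no scalar here and a
    power of [v] in [contrr_hmon_th]. *)
Lemma contrl_hmon_th al j : contrl (hm al) (th j) = th j.
Proof.
rewrite (contrlE _ (@Delta_vtheta _ _ B j)) big_cons big_seq1 /=.
by rewrite rmorph1 phi_1_hmon tauB_vtheta phi_th_hmon scale1r scale0r addr0.
Qed.

Lemma contrl_hmon_h al j :
  contrl (hm al) (h j) = v ^ form (wtau (simple_root j)) al *: h j.
Proof.
by rewrite (contrlE _ (@Delta_h _ _ B j)) big_seq1 /= tauB_h phi_h_hmon wtau_simple.
Qed.

Lemma contrr_hmon_th al j :
  contrr (hm al) (th j) = v ^ form al (simple_root j) *: th j.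
Proof.
rewrite (contrrE _ (@Delta_vtheta _ _ B j)) big_cons big_seq1 /=.
by rewrite !(phi_sym (hm al)) phi_th_hmon phi_h_hmon scale0r add0r formC.
Qed.

Lemma contrr_hmon_h al j :
  contrr (hm al) (h j) = v ^ form al (simple_root j) *: h j.
Proof.
by rewrite (contrrE _ (@Delta_h _ _ B j)) big_seq1 /= phi_sym phi_h_hmon formC.
Qed.

Lemma contrl_th_1 i : contrl (th i) 1 = 0.
Proof. by rewrite (contrlE _ grouplike1) big_seq1 rmorph1 phi_sym phi_th_1 scale0r. Qed.

Lemma contrr_th_1 i : contrr (th i) 1 = 0.
Proof. by rewrite (contrrE _ grouplike1) big_seq1 phi_th_1 scale0r. Qed.

Lemma contrl_th_th i j :
  contrl (th i) (th j) = ((tau R j == i)%:R * (vi i - (vi i)^-1)) *: h j.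
Proof.
rewrite (contrlE _ (@Delta_vtheta _ _ B j)) big_cons big_seq1 /= rmorph1 tauB_vtheta.
rewrite phi_sym phi_th_1 scale0r add0r phi_vtheta.
by case: eqP => [-> | _] //; rewrite !mul0r.
Qed.

Lemma contrr_th_th i j :
  contrr (th i) (th j) = ((j == i)%:R * (vi i - (vi i)^-1))%:A.
Proof.
rewrite (contrrE _ (@Delta_vtheta _ _ B j)) big_cons big_seq1 /= phi_vtheta_h.
by rewrite scale0r addr0 phi_vtheta eq_sym.
Qed.

Lemma contrr_th_h i j : contrr (th i) (h j) = 0.
Proof. by rewrite (contrrE _ (@Delta_h _ _ B j)) big_seq1 phi_vtheta_h scale0r. Qed.

Lemma contrl_thM i x y :
  contrl (th i) (x * y) = contrl (th i) x * contrl 1 y + contrl (h i) x * contrl (th i) y.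
Proof. by rewrite (contrlM _ _ (@Delta_vtheta _ _ B i)) big_cons big_seq1. Qed.

Lemma contrr_thM i x y :
  contrr (th i) (x * y) = contrr (th i) x * contrr 1 y + contrr (h i) x * contrr (th i) y.
Proof. by rewrite (contrrM _ _ (@Delta_vtheta _ _ B i)) big_cons big_seq1. Qed.

Lemma Bhat_generated x :
  generated (extend_gens (fun i => th i) h) x.
Proof. by case: (B_presented B). Qed.

(** [phi 1] acts as the counit. Since 1 is [hm 0], the contraction is an algebra morphism, and the
    generators suffice. *)
Lemma contrr_1 x : contrr 1 x = x.
Proof.
rewrite -hmon0; elim: (Bhat_generated x) => {x}
  [| [j|j] | x y _ IHx _ IHy | a x _ IHx | x y _ IHx _ IHy].
- exact: contrr_hmon_1.
- by rewrite contrr_hmon_th form0l expr0z scale1r.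
- by rewrite contrr_hmon_h form0l expr0z scale1r.
- by rewrite (linear_mapD (contrr_linear _)) IHx IHy.
- by rewrite (linear_mapZ (contrr_linear _)) IHx.
- by rewrite contrr_hmonM IHx IHy.
Qed.

Lemma contrl_1 x : contrl 1 x = x.
Proof.
rewrite -hmon0; elim: (Bhat_generated x) => {x}
  [| [j|j] | x y _ IHx _ IHy | a x _ IHx | x y _ IHx _ IHy].
- exact: contrl_hmon_1.
- exact: contrl_hmon_th.
- by rewrite contrl_hmon_h form0r expr0z scale1r.
- by rewrite (linear_mapD (contrl_linear _)) IHx IHy.
- by rewrite (linear_mapZ (contrl_linear _)) IHx.
- by rewrite contrl_hmonM IHx IHy.
Qed.

Lemma star_hmonl al x : star (hm al) x = hm al * contrl (hm al) x.
Proof. by rewrite (star_contrl _ (grouplike_hmon al)) big_seq1. Qed.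

Lemma star_hmonr al x : star x (hm al) = contrr (hm (wtau al)) x * hm al.
Proof. by rewrite (star_contrr _ (grouplike_hmon al)) big_seq1 tauB_hmon. Qed.

Lemma star_thl i x : star (th i) x = th i * contrl (h i) x + contrl (th i) x.
Proof.
by rewrite (star_contrl _ (@Delta_vtheta _ _ B i)) big_cons big_seq1 mul1r addrC.
Qed.

Lemma star_thr i x : star x (th i) = x * th i + contrr (th (tau R i)) x * h i.
Proof.
rewrite (star_contrr _ (@Delta_vtheta _ _ B i)) big_cons big_seq1 /=.
by rewrite rmorph1 contrr_1 tauB_vtheta.
Qed.

Lemma star1 x : star x 1 = x.
Proof. by rewrite (star_contrr _ grouplike1) big_seq1 rmorph1 contrr_1 mulr1. Qed.

Lemma star_scalar a x : star a%:A x = a *: x.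
Proof.
rewrite (linear_mapZ (star_linear_l x)) (star_contrl _ grouplike1) big_seq1.
by rewrite contrl_1 mul1r.
Qed.

Lemma contrl_hmon_hmon al be :
  contrl (hm al) (hm be) = v ^ form (wtau be) al *: hm be.
Proof.
elim/weight_ind: be => [|j be IH].
  by rewrite hmon0 wtau0 form0l contrl_hmon_1 scale1r.
rewrite hmonS contrl_hmonM IH contrl_hmon_h -scalerAl -scalerAr scalerA.
by rewrite wtauD formDl exprvD.
Qed.

Lemma contrl_hmonD al be x :
  contrl (hm (al + be)) x = contrl (hm al) (contrl (hm be) x).
Proof.
elim: (Bhat_generated x) => {x}
  [| [j|j] | x y _ IHx _ IHy | a x _ IHx | x y _ IHx _ IHy].
- by rewrite !contrl_hmon_1.
- by rewrite /= !contrl_hmon_th.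
- rewrite /= !contrl_hmon_h (linear_mapZ (contrl_linear _)) contrl_hmon_h scalerA.
  by rewrite formDr exprvD mulrC.
- by rewrite !(linear_mapD (contrl_linear _)) IHx IHy.
- by rewrite !(linear_mapZ (contrl_linear _)) IHx.
- by rewrite !contrl_hmonM IHx IHy.
Qed.

(** The morphism [contrl (hm al)] passes through [hm be] at the cost of the scalar in
    [contrl_hmon_hmon]. *)
Lemma star_hmonA al be x :
  star (hm al) (star (hm be) x) = v ^ form (wtau be) al *: star (hm (al + be)) x.
Proof.
rewrite !star_hmonl contrl_hmonM contrl_hmon_hmon -scalerAl -scalerAr.
by rewrite contrl_hmonD hmonD mulrA.
Qed.

(** By [star_hmonl] and [star_hmonr] both sides are governed by algebra morphisms that scale the
    generators, so the factor is read off on generators and the exponents add along products. *)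
Lemma star_hmonC al w x : homB w x ->
  star x (hm al) = v ^ (form (wtau al) w - form al w) *: star (hm al) x.
Proof.
rewrite star_hmonl star_hmonr => hx.
elim: hx => {w x} [w | | [j|j] | w x y _ IHx _ IHy | w a x _ IHx | w1 w2 x y _ IHx _ IHy].
- by rewrite !(linear_map0 (contrl_linear _)) !(linear_map0 (contrr_linear _)) mul0r mulr0 scaler0.
- by rewrite contrl_hmon_1 contrr_hmon_1 !form0r subrr scale1r mul1r mulr1.
- rewrite /= contrl_hmon_th contrr_hmon_th hmon_th -scalerAl scalerA -exprvD.
  by rewrite subrK.
- rewrite /= contrl_hmon_h contrr_hmon_h -!scalerAr -scalerAl scalerA -exprvD.
  rewrite -{2}hmon_simple -[h j in LHS]hmon_simple -!hmonD addrC.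
  (* The weight alpha_j + alpha_{tau j} of [h j] is fixed by [tau], so the twist vanishes on it and
     both exponents equal (tau al, alpha_j). *)
  congr (v ^ _ *: _); rewrite -wtau_simple !formDr !form_wtau !form_wtaul.
  rewrite -[form _ (wtau al)]form_wtaul !(formC al) form_wtaul; ring.
- rewrite !(linear_mapD (contrl_linear _)) !(linear_mapD (contrr_linear _)).
  by rewrite mulrDl mulrDr scalerDr IHx IHy.
- rewrite (linear_mapZ (contrl_linear _)) (linear_mapZ (contrr_linear _)).
  by rewrite -scalerAl IHx -scalerAr !scalerA mulrC.
- rewrite contrl_hmonM contrr_hmonM -mulrA IHy -scalerAr [in LHS]mulrA IHx.
  rewrite -scalerAl scalerA -exprvD -[in LHS]mulrA.
  by congr (v ^ _ *: _); rewrite !formDr; ring.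
Qed.

End IHopfProduct.

(** * Linear spans *)

Section LinearSpan.
Variable V : lmodType K.

Inductive span_of (G : V -> Prop) : V -> Prop :=
| span_zero : span_of G 0
| span_add a x y : G x -> span_of G y -> span_of G (a *: x + y).

Lemma span_gen (G : V -> Prop) x : G x -> span_of G x.
Proof. by move=> Gx; rewrite -[x]scale1r -[1 *: x]addr0; apply/span_add/span_zero. Qed.

Lemma span_ind (G P : V -> Prop) :
  P 0 -> (forall x y, P x -> P y -> P (x + y)) -> (forall a x, P x -> P (a *: x)) ->
  (forall x, G x -> P x) -> forall x, span_of G x -> P x.
Proof. by move=> P0 PD PZ GP x; elim=> // a {}x y /GP Px _; apply/PD/PZ. Qed.

Lemma spanD (G : V -> Prop) x y : span_of G x -> span_of G y -> span_of G (x + y).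
Proof.
by move=> Sx Sy; elim: Sx => [|a z t Gz _ IH]; rewrite ?add0r // -addrA; apply: span_add.
Qed.

Lemma spanZ (G : V -> Prop) a x : span_of G x -> span_of G (a *: x).
Proof.
elim=> [|b z t Gz _ IH]; first by rewrite scaler0; apply: span_zero.
by rewrite scalerDr scalerA; apply: span_add.
Qed.

End LinearSpan.

Lemma span_map (U V : lmodType K) (f : U -> V) (G : U -> Prop) (G' : V -> Prop) x :
  linear f -> (forall y, G y -> span_of G' (f y)) -> span_of G x -> span_of G' (f x).
Proof.
move=> fL Gf; elim/span_ind=> {x} [|x y|a x|x]; last exact: Gf.
- by rewrite (linear_map0 fL); apply: span_zero.
- by rewrite (linear_mapD fL); apply: spanD.
- by rewrite (linear_mapZ fL); apply: spanZ.
Qed.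

(** * Words in the [vtheta_i], their skew derivations and their weights *)

Section Words.
Variables (R : root_data) (F : falgebra R) (B : Bhat F).
Implicit Types (x y : B) (i j k : R) (s t : seq R) (al be w : weight R).
Local Notation th i := (iota B (vtheta F i)).
Local Notation h := (hgen B).
Local Notation hm := (hmon B).

Definition word s : F := \prod_(i <- s) vtheta F i.
Definition word_wt s : weight R := \sum_(i <- s) simple_root i.

Lemma word_cons k s : word (k :: s) = vtheta F k * word s.
Proof. exact: big_cons. Qed.

Lemma word_wt_cons k s : word_wt (k :: s) = simple_root k + word_wt s.
Proof. exact: big_cons. Qed.

Lemma words_span (u : F) : span_of (fun z => exists s, z = word s) u.
Proof.
have [_ gen _] := f_presented F.
pose P u := span_of (fun z => exists s, z = word s) u.
apply: (homogeneous_spans (wt := @simple_root R) (P := P) gen).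
- exact: span_zero.
- by move=> y z; apply: spanD.
move=> w y; apply: (homogeneous_left_ind (P := fun _ => P)) => {w y}
  [_||_ y z|_ a y|j _ y].
- exact: span_zero.
- by apply: span_gen; exists [::]; rewrite /word big_nil.
- exact: spanD.
- exact: spanZ.
apply: (span_map (f := *%R (vtheta F j))) => [a z t|_ [s ->]].
  by rewrite mulrDr scalerAr.
by apply: span_gen; exists (j :: s); rewrite word_cons.
Qed.

Lemma word_ind (P : F -> Prop) :
  P 0 -> (forall u u', P u -> P u' -> P (u + u')) -> (forall a u, P u -> P (a *: u)) ->
  (forall s, P (word s)) -> forall u, P u.
Proof.
move=> P0 PD PZ Pw u; elim/span_ind: (words_span u) => // _ [s ->]; exact: Pw.
Qed.

Lemma contrl_hmon_iota al (u : F) : contrl (hm al) (iota B u) = iota B u.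
Proof.
elim/word_ind: u => [|u u' IHu IHu'|a u IHu|s].
- by rewrite rmorph0 (linear_map0 (contrl_linear _)).
- by rewrite rmorphD (linear_mapD (contrl_linear _)) IHu IHu'.
- by rewrite linearZ (linear_mapZ (contrl_linear _)) IHu.
elim: s => [|k s IH]; first by rewrite /word big_nil rmorph1 contrl_hmon_1.
by rewrite word_cons rmorphM contrl_hmonM IH contrl_hmon_th.
Qed.

Definition vdiff j : K := vi j - (vi j)^-1.

(* Lusztig's skew derivation r_j of f, rescaled to the generators vtheta and
   evaluated on words. *)
Fixpoint dword j s : F :=
  if s is k :: s' then
    ((k == j)%:R * vdiff j) *: word s' +
    v ^ (- form (simple_root j) (simple_root k)) *: (vtheta F k * dword j s')
  else 0.

(** The derivation deletes one letter [j]. The drop in length drives the inductions on words, and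
    the weight identity keeps track of the grading. *)
Lemma dword_span j s :
  span_of (fun z => exists t, [/\ (size t < size s)%N,
     simple_root j + word_wt t = word_wt s & z = word t]) (dword j s).
Proof.
elim: s => [|k s IH] /=; first exact: span_zero.
apply: spanD.
  have [-> | _] := eqVneq k j; last by rewrite mul0r scale0r; apply: span_zero.
  by apply/spanZ/span_gen; exists s; rewrite word_wt_cons.
apply: spanZ; apply: (span_map (f := *%R (vtheta F k))) IH => [a y z|_ [t [ltts wtt ->]]].
  by rewrite mulrDr scalerAr.
apply: span_gen; exists (k :: t); split=> //; last by rewrite word_cons.
by rewrite !word_wt_cons -wtt addrCA.
Qed.

Lemma vdiff_tau i : vdiff (tau R i) = vdiff i.
Proof. by rewrite /vdiff /vi dsym_tau. Qed.

(** The skew derivation produces [h (tau R i)] at each letter tau i; moving it to the front past the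
    preceding letters costs exactly the powers of [v] built into [dword]. *)
Lemma contrl_th_word i s :
  contrl (th i) (iota B (word s)) = h (tau R i) * iota B (dword (tau R i) s).
Proof.
elim: s => [|k s IH].
  by rewrite /word big_nil /= !rmorph1 rmorph0 contrl_th_1 mulr0.
rewrite word_cons rmorphM contrl_thM contrl_1 IH -hmon_simple contrl_hmon_th contrl_th_th.
rewrite /= rmorphD /= !linearZ /= rmorphM [in RHS]mulrDr -/(vdiff i).
rewrite -!scalerAr -!scalerAl vdiff_tau (inv_eq (@tau_involutive R)).
congr (_ + _); first by have [-> | _] := eqVneq k (tau R i); rewrite ?mul0r ?scale0r.
rewrite [in RHS]mulrA Bhat_h_th -scalerAl scalerA -exprvD addNr expr0z scale1r.
by rewrite mulrA.
Qed.

(** [sigma] turns the first letter into the last, where [contrr] meets it on the other side; the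
    outer [contrr (h j)] scales that letter and cancels the power of [v] in [dword]. *)
Lemma contrr_th_word j s :
  contrr (th j) (iota B (sigma (word s))) =
  contrr (h j) (iota B (sigma (dword j s))).
Proof.
have sigZ := linear_mapZ (@sigma_linear R F).
elim: s => [|k s IH].
  rewrite /word big_nil /= sigma_one rmorph1 contrr_th_1.
  by rewrite (linear_map0 (@sigma_linear R F)) rmorph0 (linear_map0 (contrr_linear _)).
rewrite word_cons sigma_mul rmorphM sigma_vtheta contrr_thM contrr_1 IH contrr_th_th /=.
rewrite (linear_mapD (@sigma_linear R F)) !sigZ sigma_mul sigma_vtheta.
rewrite rmorphD /= !linearZ /= rmorphM (linear_mapD (contrr_linear _)).
rewrite !(linear_mapZ (contrr_linear _)) -hmon_simple contrr_hmonM contrr_hmon_th.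
rewrite -!scalerAr scalerA -exprvD addNr expr0z scale1r mulr1 addrC.
by congr (_ *: _ + _); case: eqP => // ->.
Qed.

(** Multiplication by vtheta_k in [star] exceeds the ordinary one by a contraction. Subtracting it
    expresses a word through [star] products of generators with shorter words, where [bar] and
    [sigma_i] can be evaluated. *)
Lemma iota_word_cons k s :
  iota B (word (k :: s)) = star (th k) (iota B (word s)) -
    star (hm (simple_root (tau R k))) (iota B (dword (tau R k) s)).
Proof.
rewrite star_thl -hmon_simple contrl_hmon_iota star_hmonl contrl_hmon_iota.
by rewrite contrl_th_word hmon_simple addrK word_cons rmorphM.
Qed.

Lemma star_word_ind (P : weight R -> B -> Prop) :
  (forall w, P w 0) -> P 0 1 ->
  (forall w x y, P w x -> P w y -> P w (x + y)) ->
  (forall w a x, P w x -> P w (a *: x)) ->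
  (forall al w x, P w x -> P (al + wtau al + w) (star (hm al) x)) ->
  (forall i w x, P w x -> P (simple_root i + w) (star (th i) x)) ->
  forall s, P (word_wt s) (iota B (word s)).
Proof.
move=> P0 P1 PD PZ Ph Pth s; have [n] := ubnP (size s).
elim: n s => // n IHn [|k s] lts.
  by rewrite /word /word_wt !big_nil rmorph1.
rewrite iota_word_cons -scaleN1r word_wt_cons; apply: (PD).
  by apply/Pth/IHn.
apply: (PZ); elim/span_ind: (dword_span (tau R k) s) => [|y z|a y|_ [t [ltts wtt ->]]].
- by rewrite rmorph0 (linear_map0 (star_linear _)).
- by rewrite rmorphD (linear_mapD (star_linear _)); apply: PD.
- by rewrite linearZ (linear_mapZ (star_linear _)); apply: PZ.
(* The deleted letter has weight alpha_{tau k}; together with alpha_k it makes up the weight of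
   [h (tau R k)]. *)
rewrite -wtt -{1}(@tau_involutive R k) -wtau_simple addrA (addrC (wtau _)).
by apply: Ph; apply: IHn; apply: leq_trans ltts _; apply: ltnW.
Qed.

(** Normal ordering: [hmon_th] carries each new vtheta_j past [hm al] into the word. *)
Lemma homB_span w x : homB w x ->
  span_of (fun y => exists al s,
    al + wtau al + word_wt s = w /\ y = hm al * iota B (word s)) x.
Proof.
pose P w x := span_of (fun y => exists al s,
    al + wtau al + word_wt s = w /\ y = hm al * iota B (word s)) x.
apply: (homogeneous_left_ind (P := P)) => {w x} [w||w y z|w a y|j w x].
- exact: span_zero.
- apply: span_gen; exists 0, [::].
  split; first by rewrite wtau0 /word_wt big_nil !addr0.
  by rewrite /word big_nil rmorph1 hmon0 mulr1.
- exact: spanD.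
- exact: spanZ.
apply: span_map => [a y z | _ [al [s [wts ->]]]]; first by rewrite mulrDr scalerAr.
case: j => j /=; last first.
  apply: span_gen; exists (simple_root j + al), s.
  split; last by rewrite hmonS mulrA.
  by rewrite -wts wtauD wtau_simple addrACA -!addrA.
have -> : th j * (hm al * iota B (word s)) =
  v ^ (- form al (simple_root j)) *: (hm al * iota B (word (j :: s))).
  rewrite word_cons rmorphM [in RHS]mulrA hmon_th -[in RHS]scalerAl scalerA.
  by rewrite -exprvD addNr expr0z scale1r mulrA.
apply/spanZ/span_gen; exists al, (j :: s); split=> //.
by rewrite word_wt_cons addrCA wts.
Qed.

(** The normally ordered element [hm al * iota B (word s)] is also a [star] product, because
    [contrl (hm al)] fixes the image of [iota]; [star_word_ind] then treats the word. *)
Lemma star_homogeneous_ind (P : weight R -> B -> Prop) :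
  (forall w, P w 0) -> P 0 1 ->
  (forall w x y, P w x -> P w y -> P w (x + y)) ->
  (forall w a x, P w x -> P w (a *: x)) ->
  (forall al w x, P w x -> P (al + wtau al + w) (star (hm al) x)) ->
  (forall i w x, P w x -> P (simple_root i + w) (star (th i) x)) ->
  forall w x, homB w x -> P w x.
Proof.
move=> P0 P1 PD PZ Ph Pth w x /homB_span.
elim/span_ind=> {x} [||a x|_ [al [s [<- ->]]]] //; [exact: PD | exact: PZ |].
have := Ph al _ _ (star_word_ind P0 P1 PD PZ Ph Pth s).
by rewrite star_hmonl contrl_hmon_iota.
Qed.

Lemma Bhat_hom_ind (P : B -> Prop) :
  P 0 -> (forall x y, P x -> P y -> P (x + y)) ->
  (forall w x, homB w x -> P x) -> forall x, P x.
Proof. by case: (B_presented B) => _ gen _; apply: homogeneous_spans. Qed.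

Lemma f_hom_ind (P : F -> Prop) :
  P 0 -> (forall u u', P u -> P u' -> P (u + u')) ->
  (forall w u, homf w u -> P u) -> forall u, P u.
Proof. by case: (f_presented F) => _ gen _; apply: homogeneous_spans. Qed.

Lemma homB_hmon al : homB (al + wtau al) (hm al).
Proof.
elim/weight_ind: al => [|i al IH].
  by rewrite wtau0 addr0 hmon0; apply: hom_one.
rewrite wtauD wtau_simple hmonS addrACA; apply: hom_mul IH.
exact: (hom_gen _ _ (inr i)).
Qed.

Lemma homB_contrl_hmon al w x : homB w x -> homB w (contrl (hm al) x).
Proof.
elim=> {w x} [w | | [j|j] | w x y _ IHx _ IHy | w a x _ IHx | w1 w2 x y _ IHx _ IHy].
- by rewrite (linear_map0 (contrl_linear _)); apply: hom_zero.
- by rewrite contrl_hmon_1; apply: hom_one.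
- by rewrite /= contrl_hmon_th; apply: (hom_gen _ _ (inl j)).
- by rewrite /= contrl_hmon_h; apply/hom_scale/(hom_gen _ _ (inr j)).
- by rewrite (linear_mapD (contrl_linear _)); apply: hom_add.
- by rewrite (linear_mapZ (contrl_linear _)); apply: hom_scale.
- by rewrite contrl_hmonM; apply: hom_mul.
Qed.

Lemma homB_contrr_hmon al w x : homB w x -> homB w (contrr (hm al) x).
Proof.
elim=> {w x} [w | | [j|j] | w x y _ IHx _ IHy | w a x _ IHx | w1 w2 x y _ IHx _ IHy].
- by rewrite (linear_map0 (contrr_linear _)); apply: hom_zero.
- by rewrite contrr_hmon_1; apply: hom_one.
- by rewrite /= contrr_hmon_th; apply/hom_scale/(hom_gen _ _ (inl j)).
- by rewrite /= contrr_hmon_h; apply/hom_scale/(hom_gen _ _ (inr j)).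
- by rewrite (linear_mapD (contrr_linear _)); apply: hom_add.
- by rewrite (linear_mapZ (contrr_linear _)); apply: hom_scale.
- by rewrite contrr_hmonM; apply: hom_mul.
Qed.

Lemma homB_star_hmon al w x : homB w x -> homB (al + wtau al + w) (star (hm al) x).
Proof.
by move=> hx; rewrite star_hmonl; apply: hom_mul (homB_hmon al) (homB_contrl_hmon al hx).
Qed.

Lemma homB_h_comm i w x : homB w x -> exists2 y, homB w y & x * h i = h i * y.
Proof.
elim=> {w x} [w | | [j|j] | w x y _ [x' hx Ex] _ [y' hy Ey]
  | w a x _ [x' hx Ex] | w1 w2 x y _ [x' hx Ex] _ [y' hy Ey]].
- by exists 0; [apply: hom_zero | rewrite mul0r mulr0].
- by exists 1; [apply: hom_one | rewrite mul1r mulr1].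
- exists (v ^ (- form (simple_root i) (simple_root j)) *: th j).
    exact/hom_scale/(hom_gen _ _ (inl j)).
  by rewrite -scalerAr Bhat_h_th scalerA -exprvD addNr expr0z scale1r.
- by exists (h j); [apply: (hom_gen _ _ (inr j)) | apply: Bhat_h_comm].
- by exists (x' + y'); [apply: hom_add | rewrite mulrDl mulrDr Ex Ey].
- by exists (a *: x'); [apply: hom_scale | rewrite -scalerAl -scalerAr Ex].
- by exists (x' * y'); [apply: hom_mul | rewrite -mulrA Ey !mulrA Ex].
Qed.

(** The contraction removes alpha_{tau i}, and [h i] contributes alpha_i + alpha_{tau i}. *)
Lemma homB_contrr_th i w x : homB w x ->
  homB (w + simple_root i) (contrr (th (tau R i)) x * h i).
Proof.
elim=> {w x} [w | | [j|j] | w x y _ IHx _ IHy | w a x _ IHx | w1 w2 x y hx IHx hy IHy].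
- by rewrite (linear_map0 (contrr_linear _)) mul0r; apply: hom_zero.
- by rewrite contrr_th_1 mul0r; apply: hom_zero.
- rewrite /= contrr_th_th -scalerAl mul1r.
  have [-> | _] := eqVneq; last by rewrite mul0r scale0r; apply: hom_zero.
  by apply: hom_scale; rewrite addrC; apply: (hom_gen _ _ (inr i)).
- by rewrite contrr_th_h mul0r; apply: hom_zero.
- by rewrite (linear_mapD (contrr_linear _)) mulrDl; apply: hom_add.
- by rewrite (linear_mapZ (contrr_linear _)) -scalerAl; apply: hom_scale.
(* In the first summand [h i] is moved to the left of [y], next to the contraction of [x], to meet
   the induction hypothesis. *)
rewrite contrr_thM contrr_1 mulrDl -mulrA; have [y' hy' ->] := homB_h_comm i hy.
apply: hom_add; first by rewrite mulrA addrAC; apply: hom_mul.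
by rewrite -mulrA -addrA; apply: hom_mul => //; rewrite -hmon_simple; apply: homB_contrr_hmon.
Qed.

Lemma homB_star_th i w x : homB w x -> homB (w + simple_root i) (star x (th i)).
Proof.
move=> hx; rewrite star_thr; apply: hom_add (homB_contrr_th i hx).
exact: hom_mul hx (hom_gen _ _ (inl i)).
Qed.

Lemma homB_iota w (u : F) : homf w u -> homB w (iota B u).
Proof.
elim=> {w u} [w | | j | w x y _ IHx _ IHy | w a x _ IHx | w1 w2 x y hx IHx hy IHy].
- by rewrite rmorph0; apply: hom_zero.
- by rewrite rmorph1; apply: hom_one.
- exact: (hom_gen _ _ (inl j)).
- by rewrite rmorphD; apply: hom_add.
- by rewrite linearZ; apply: hom_scale.
- by rewrite rmorphM; apply: hom_mul.
Qed.

Lemma homf_sigma w (u : F) : homf w u -> homf w (sigma u).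
Proof.
elim=> {w u} [w | | j | w x y _ IHx _ IHy | w a x _ IHx | w1 w2 x y hx IHx hy IHy].
- by rewrite (linear_map0 (@sigma_linear R F)); apply: hom_zero.
- by rewrite sigma_one; apply: hom_one.
- by rewrite sigma_vtheta; apply: hom_gen.
- by rewrite (linear_mapD (@sigma_linear R F)); apply: hom_add.
- by rewrite (linear_mapZ (@sigma_linear R F)); apply: hom_scale.
- by rewrite sigma_mul addrC; apply: hom_mul.
Qed.

End Words.

(** * The bar involution, [sigma_i] and the operators [Kdiam] *)

Section Involutions.
Variables (R : root_data) (F : falgebra R) (B : Bhat F) (H : iHopf B).
Implicit Types (x y : B) (i j k : R) (al be w : weight R) (u : F).
Local Notation th i := (iota B (vtheta F i)).
Local Notation h := (hgen B).
Local Notation hm := (hmon B).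
Local Notation bar := (bar H).
Local Notation sigi := (sigma_i H).

Let sigiD := linear_mapD (sigma_i_linear H).
Let sigiZ := linear_mapZ (sigma_i_linear H).
Let sigi0 := linear_map0 (sigma_i_linear H).
Let sigD := linear_mapD (@sigma_linear R F).
Let sigZ := linear_mapZ (@sigma_linear R F).
Let sig0 := linear_map0 (@sigma_linear R F).

Lemma bar0 : bar 0 = 0.
Proof. by apply: (addrI (bar 0)); rewrite -bar_add !addr0. Qed.

Lemma barN x : bar (- x) = - bar x.
Proof. by apply: (addrI (bar x)); rewrite -bar_add !subrr bar0. Qed.

(** Scaling by [a] is [star] with the scalar element of [a], so reversing products makes [bar]
    semilinear wherever it sends a scalar to a scalar. *)
Lemma bar_scale_of a a' x : bar a%:A = a'%:A -> bar (a *: x) = a' *: bar x.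
Proof.
move=> Ea; rewrite -(star_scalar a x) bar_star Ea.
by rewrite (linear_mapZ (star_linear _)) star1.
Qed.

(** On scalars, [bar] is prescribed at [vhalf] only; this predicate serves to extend semilinearity
    to all of [K]. *)
Definition bar_scalar (a : K) := exists a', bar a%:A = a'%:A.

Lemma bar_scalar1 : bar_scalar 1.
Proof. by exists 1; rewrite scale1r bar_one. Qed.

Lemma bar_scalarD a b : bar_scalar a -> bar_scalar b -> bar_scalar (a + b).
Proof.
by move=> [a' Ea] [b' Eb]; exists (a' + b'); rewrite !scalerDl bar_add Ea Eb.
Qed.

Lemma bar_scalarN a : bar_scalar a -> bar_scalar (- a).
Proof. by move=> [a' Ea]; exists (- a'); rewrite !scaleNr barN Ea. Qed.

Lemma bar_scalarM a b : bar_scalar a -> bar_scalar b -> bar_scalar (a * b).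
Proof.
move=> [a' Ea] [b' Eb]; exists (a' * b').
by rewrite -scalerA (bar_scale_of _ Ea) Eb scalerA.
Qed.

Lemma bar_scalarV_eq a a' : a != 0 -> bar a%:A = a'%:A -> bar (a^-1)%:A = (a'^-1)%:A.
Proof.
move=> a_neq0 Ea.
have E1 : a' *: bar (a^-1)%:A = 1.
  by rewrite -(bar_scale_of _ Ea) scalerA mulfV // scale1r bar_one.
have a'_neq0 : a' != 0.
  by apply: contraTneq (oner_neq0 B) => a'0; rewrite -E1 a'0 scale0r eqxx.
by rewrite -[LHS]scale1r -(mulVf a'_neq0) -scalerA E1.
Qed.

Lemma bar_scalarV a : bar_scalar a -> bar_scalar a^-1.
Proof.
move=> [a' Ea]; have [->|a_neq0] := eqVneq a 0.
  by exists 0; rewrite invr0 scale0r bar0.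
by exists a'^-1; apply: bar_scalarV_eq.
Qed.

(** The scalars in question form a subfield containing [vhalf], hence contain the rationals, the
    polynomials and their quotients. *)
Lemma bar_scalarP a : bar_scalar a.
Proof.
have scal0 : bar_scalar 0 by exists 0; rewrite scale0r bar0.
have scal_nat n : bar_scalar n%:R.
  by elim: n => // n IHn; rewrite mulrS; apply: bar_scalarD IHn; apply: bar_scalar1.
have scal_int n : bar_scalar n%:~R.
  case: n => n; first exact: scal_nat.
  by rewrite NegzE mulrNz; apply/bar_scalarN/scal_nat.
have scal_rat (q : rat) : bar_scalar (tofrac q%:P).
  have tofrac_int (m : int) : tofrac (m%:~R : rat)%:P = m%:~R by rewrite !rmorph_int.
  have -> : tofrac q%:P = (numq q)%:~R / (denq q)%:~R.
    apply: (canRL (mulfK _)).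
      by rewrite -tofrac_int tofrac_eq0 polyC_eq0 intr_eq0 denq_neq0.
    by rewrite -!tofrac_int numqE -tofracM polyCM.
  by apply: bar_scalarM; last apply: bar_scalarV; apply: scal_int.
have scal_poly (p : {poly rat}) : bar_scalar (tofrac p).
  elim/poly_ind: p => [|p c IHp]; first by rewrite tofrac0.
  rewrite tofracD tofracM; apply: bar_scalarD; last exact: scal_rat.
  by apply: bar_scalarM => //; exists vhalf^-1; apply: bar_vhalf.
have [n [d [_ ->]]] := fraction_num_den a.
by apply: bar_scalarM; last apply: bar_scalarV; apply: scal_poly.
Qed.

Lemma bar_scale a : exists a', forall x, bar (a *: x) = a' *: bar x.
Proof. by have [a' Ea] := bar_scalarP a; exists a' => x; apply: bar_scale_of. Qed.

Lemma bar_vhalf_expz (n : int) x : bar (vhalf ^ n *: x) = vhalf ^ (- n) *: bar x.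
Proof.
have bar_exp m : bar (vhalf ^+ m)%:A = (vhalf ^- m)%:A.
  elim: m => [|m IHm]; first by rewrite expr0 invr1 !scale1r bar_one.
  rewrite exprS -scalerA (bar_scale_of _ (bar_vhalf H)) IHm scalerA.
  by rewrite invfM.
apply: bar_scale_of; case: n => m; first by rewrite bar_exp -exprnN.
rewrite NegzE opprK -exprnN (bar_scalarV_eq _ (bar_exp _)) ?expf_neq0 ?vhalf_neq0 //.
by rewrite invrK.
Qed.

Lemma v_expzE (n : int) : v ^ n = vhalf ^ (2 * n).
Proof. by rewrite -exprz_exp. Qed.

Lemma exprvhD (m n : int) : vhalf ^ (m + n) = vhalf ^ m * vhalf ^ n.
Proof. exact: expfzDr vhalf_neq0. Qed.

(** [bar] moves generators to the right; [star_hmonC] and [homB_star_th] show that the weight is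
    unaffected. This lets [bar_Kdiam] apply the homogeneous formulas to [bar x]. *)
Lemma homB_bar w x : homB w x -> homB w (bar x).
Proof.
move: w x; apply: star_homogeneous_ind => [w||w x y hx hy|w a x hx|al w x hx|i w x hx].
- by rewrite bar0; apply: hom_zero.
- by rewrite bar_one; apply: hom_one.
- by rewrite bar_add; apply: hom_add.
- by have [a' ->] := bar_scale a; apply: hom_scale.
- rewrite bar_star bar_h (linear_mapZ (star_linear _)) (star_hmonC al hx).
  by do 2![apply: hom_scale]; apply: homB_star_hmon.
- by rewrite bar_star bar_vtheta addrC; apply: homB_star_th.
Qed.

(** Both composites preserve the order of [star] products and act alike on scalars and on the
    vtheta_i; on [hm al] they agree because (al, tau al) is unchanged by [tau]. *)
Lemma bar_sigma_i x : bar (sigi x) = sigi (bar x).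
Proof.
elim/Bhat_hom_ind: x => [|x y IHx IHy|w x].
- by rewrite sigi0 bar0 sigi0.
- by rewrite sigiD !bar_add sigiD IHx IHy.
apply: (star_homogeneous_ind (P := fun _ x => bar (sigi x) = sigi (bar x))) => {w x}
  [w||w x y IHx IHy|w a x IHx|al w x IHx|i w x IHx].
- by rewrite sigi0 bar0 sigi0.
- by rewrite sigma_i_one bar_one sigma_i_one.
- by rewrite sigiD !bar_add sigiD IHx IHy.
- by have [a' Ea] := bar_scale a; rewrite sigiZ !Ea sigiZ IHx.
- rewrite sigma_i_star !bar_star sigma_i_star sigma_i_h !bar_h sigiZ sigma_i_h.
  by rewrite IHx wtauK form_wtaul formC.
- by rewrite sigma_i_star !bar_star sigma_i_star sigma_i_vtheta !bar_vtheta sigma_i_vtheta IHx.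
Qed.

Lemma sigma_i_iota u : sigi (iota B u) = iota B (sigma u).
Proof.
elim/word_ind: u => [|u u' IHu IHu'|a u IHu|s].
- by rewrite rmorph0 sigi0 sig0 rmorph0.
- by rewrite rmorphD sigiD sigD rmorphD IHu IHu'.
- by rewrite linearZ sigiZ sigZ linearZ IHu.
have [n] := ubnP (size s); elim: n s => // n IHn [|k s] lts.
  by rewrite /word big_nil sigma_one rmorph1 sigma_i_one.
rewrite iota_word_cons (linear_mapB (sigma_i_linear H)) !sigma_i_star.
rewrite sigma_i_vtheta sigma_i_h (IHn s) //.
(* The derivative is a combination of words shorter than [s], to which the induction hypothesis
   extends linearly. *)
have -> : sigi (iota B (dword F (tau R k) s)) = iota B (sigma (dword F (tau R k) s)).
  elim/span_ind: (dword_span F (tau R k) s) => [|u u' IHu IHu'|a u IHu|_ [t [ltts _ ->]]].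
  - by rewrite rmorph0 sigi0 sig0 rmorph0.
  - by rewrite rmorphD sigiD sigD rmorphD IHu IHu'.
  - by rewrite linearZ sigiZ sigZ linearZ IHu.
  by apply: IHn; apply: leq_trans ltts _; apply: ltnW.
(* The contraction term of [star_thr] becomes [contrr (h (tau R k))] of the reversed derivative
   times [h k], which by [star_hmonr] is exactly the subtracted term. *)
rewrite star_thr contrr_th_word star_hmonr wtauK wtau_simple tau_involutive !hmon_simple.
by rewrite addrK word_cons sigma_mul sigma_vtheta rmorphM.
Qed.

Lemma Kdiam_linear al : linear (Kdiam H al).
Proof.
move=> a x y; rewrite /Kdiam hdiam_linear scalerDr; congr (_ + _).
by rewrite !scalerA mulrC.
Qed.

Lemma Kdiam_homl al w x : homB w x ->
  Kdiam H al x =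
  vhalf ^ (form al (wtau al) + form al w - form (wtau al) w) *: star (hm (wtau al)) x.
Proof.
by move=> hx; rewrite /Kdiam (hdiam_hom _ _ hx) wtauK scalerA -exprvhD addrA.
Qed.

(** The normalization of [Kdiam] takes half of the exponent in [star_hmonC], so moving [hm] to the
    right only changes the sign of the twist. *)
Lemma Kdiam_homr al w x : homB w x ->
  Kdiam H al x =
  vhalf ^ (form al (wtau al) + form (wtau al) w - form al w) *: star x (hm (wtau al)).
Proof.
move=> hx; rewrite (Kdiam_homl _ hx) (star_hmonC _ hx) wtauK v_expzE scalerA -exprvhD.
by congr (vhalf ^ _ *: _); ring.
Qed.

Lemma KdiamD al be x : Kdiam H al (Kdiam H be x) = Kdiam H (al + be) x.
Proof.
elim/Bhat_hom_ind: x => [|x y IHx IHy|w x hx].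
- by rewrite !(linear_map0 (Kdiam_linear _)).
- by rewrite !(linear_mapD (Kdiam_linear _)) IHx IHy.
rewrite (Kdiam_homl be hx) (linear_mapZ (Kdiam_linear _)).
rewrite (Kdiam_homl al (homB_star_hmon (wtau be) hx)) (Kdiam_homl _ hx).
rewrite star_hmonA v_expzE !scalerA -!exprvhD wtauD !wtauK.
(* The tau-invariant weight of [hm (wtau be)] does not contribute to the twist, and the factor from
   [star_hmonA] supplies the cross terms of the form at [al + be]. *)
congr (vhalf ^ _ *: _); rewrite !(formDl, formDr) !form_wtaul.
rewrite (formC be (wtau al)) !form_wtaul !wtauK; lia.
Qed.

(** [bar] turns the left expression into the right one with the twist negated; the factor in [bar_h]
    restores the inverted prefactor. *)
Lemma bar_Kdiam al x : bar (Kdiam H al x) = Kdiam H al (bar x).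
Proof.
elim/Bhat_hom_ind: x => [|x y IHx IHy|w x hx].
- by rewrite (linear_map0 (Kdiam_linear _)) bar0 (linear_map0 (Kdiam_linear _)).
- by rewrite bar_add !(linear_mapD (Kdiam_linear _)) bar_add IHx IHy.
rewrite (Kdiam_homl al hx) (Kdiam_homr al (homB_bar hx)) bar_vhalf_expz bar_star.
rewrite bar_h (linear_mapZ (star_linear _)) v_expzE scalerA -exprvhD wtauK.
by congr (vhalf ^ _ *: _); rewrite !form_wtaul; lia.
Qed.

(** [sigma_i] turns the left expression for [al] into the right expression for [wtau al], with the
    same exponent. *)
Lemma sigma_i_Kdiam_iota al u :
  sigi (Kdiam H al (iota B u)) = Kdiam H (wtau al) (iota B (sigma u)).
Proof.
elim/f_hom_ind: u => [|u u' IHu IHu'|w u hu].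
- by rewrite sig0 !rmorph0 !(linear_map0 (Kdiam_linear _)) sigi0.
- by rewrite sigD !rmorphD !(linear_mapD (Kdiam_linear _)) sigiD IHu IHu'.
rewrite (Kdiam_homl _ (homB_iota B hu)) (Kdiam_homr _ (homB_iota B (homf_sigma hu))).
by rewrite sigiZ sigma_i_star sigma_i_h sigma_i_iota wtauK form_wtaul formC.
Qed.

Lemma dual_ican_Kdiam al be u x :
  dual_ican H be u x -> dual_ican H (al + be) u (Kdiam H al x).
Proof.
move=> [barx [s [sP defx]]]; split; first by rewrite bar_Kdiam barx.
exists [seq (t.1, (al + t.2.1, t.2.2)) | t <- s]; split.
  by move=> _ /mapP[t /sP tP ->].
rewrite defx (linear_mapD (Kdiam_linear _)) KdiamD (linear_map_sum (Kdiam_linear _)) big_map.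
congr (_ + _); apply: eq_bigr => t _.
by rewrite (linear_mapZ (Kdiam_linear _)) KdiamD.
Qed.

Lemma dual_ican_sigma al u x :
  (forall b, dual_canonical B b -> dual_canonical B (sigma b)) ->
  dual_ican H al u x -> dual_ican H (wtau al) (sigma u) (sigi x).
Proof.
move=> sigC [barx [s [sP defx]]]; split; first by rewrite bar_sigma_i barx.
exists [seq (t.1, (wtau t.2.1, sigma t.2.2)) | t <- s]; split.
  by move=> _ /mapP[t /sP[cP bP] ->]; split=> //; apply: sigC.
rewrite defx sigiD sigma_i_Kdiam_iota (linear_map_sum (sigma_i_linear H)) big_map.
congr (_ + _); apply: eq_bigr => t _.
by rewrite sigiZ sigma_i_Kdiam_iota.
Qed.

End Involutions.

Theorem proposition4p10 (R : root_data) (F : falgebra R) (B : Bhat F)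
    (H : iHopf B)
    (sigma_C : preserved (@sigma R F) (dual_canonical B))
    (C : weight R -> F -> B)
    (C_def : forall (al : weight R) (b : F), dual_canonical B b ->
       unique (dual_ican H al b) (C al b)) :
  [/\ forall (al : weight R) (b : F), dual_canonical B b ->
        C al b = Kdiam H al (C 0 b),
      preserved (@sigma_i R F B H)
        (fun y : B => exists (al : weight R) (b : F),
           dual_canonical B b /\ y = C al b)
    & forall (al : weight R) (b : F), dual_canonical B b ->
        sigma_i H (C al b) = C (wtau al) (sigma b)].
Proof.
have sigC b : dual_canonical B b -> dual_canonical B (sigma b).
  by move=> bP; apply/sigma_C; exists b.
have sigmaC al b : dual_canonical B b -> sigma_i H (C al b) = C (wtau al) (sigma b).
  move=> bP; have [Cb _] := C_def al b bP.
  have [_ uniqC] := C_def (wtau al) _ (sigC b bP).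
  by apply/esym/uniqC/dual_ican_sigma.
split=> // [al b bP | y].
  have [_ uniqC] := C_def al b bP; apply: uniqC.
  (* The expansion of C_{0,b}, shifted by [al], satisfies the characterization of C_{al,b}. *)
  by rewrite -[X in dual_ican _ X]addr0; apply: dual_ican_Kdiam; case: (C_def 0 b bP).
split=> [[al [b [bP ->]]] | [x [al [b [bP ->]]] ->]].
  (* This is a preimage since [wtau] and [sigma] are involutions. *)
  exists (C (wtau al) (sigma b)); first by exists (wtau al), (sigma b); split; first exact: sigC.
  by rewrite sigmaC ?wtauK ?sigma_invol //; apply: sigC.
by exists (wtau al), (sigma b); split; [apply: sigC | apply: sigmaC].
Qed.
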